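(* Let $S$ be a finite non-Dedekind group, let $G = S\times S$, and let $\mathbf{A}, \mathbf{B}, \mathbf{C}$ be the algebras, with one unary operation for each $g\in G$, defined from $S$ in the context. Then the relation associating to each pair $((x_1,x_2)T_1,(y_1,y_2)T_2)\in \mathbf{A}\times\mathbf{C}$ the pair $((x_2,y_1)D,(y_1,y_2)T_2)\in\mathbf{B}\times\mathbf{C}$ is a well-defined function $\varphi:\mathbf{A}\times\mathbf{C}\to\mathbf{B}\times\mathbf{C}$ and is an isomorphism of algebras; consequently $\mathbf{A}\sim_{\mathbf{C}}\mathbf{B}$, so $\mathbf{A}$ and $\mathbf{B}$ are isotopic. Moreover, $\operatorname{Con}\mathbf{A}\cong\operatorname{Sub}(S)$ and $\operatorname{Con}\mathbf{B}\cong\operatorname{NSub}(S)$, where $\operatorname{NSub}(S)\subsetneq\operatorname{Sub}(S)$, and $\operatorname{Con}\mathbf{A}\not\cong\operatorname{Con}\mathbf{B}$ as lattices. In particular, there exist isotopic algebras with non-isomorphic congruence lattices.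
   Context: Algebras are in the sense of universal algebra; $\operatorname{Con}\mathbf{A}$ denotes the congruence lattice of an algebra $\mathbf{A}$. If $\mathbf{A},\mathbf{B},\mathbf{C}$ are algebras of the same signature, then $\mathbf{A}$ and $\mathbf{B}$ are isotopic over $\mathbf{C}$, written $\mathbf{A}\sim_{\mathbf{C}}\mathbf{B}$, if there is an isomorphism $\varphi:\mathbf{A}\times\mathbf{C}\to\mathbf{B}\times\mathbf{C}$ such that for all $a\in A$, $c\in C$ the second coordinate of $\varphi(a,c)$ is $c$. $\mathbf{A}$ and $\mathbf{B}$ are isotopic, written $\mathbf{A}\sim\mathbf{B}$, if $\mathbf{A}\sim_{\mathbf{C}}\mathbf{B}$ for some $\mathbf{C}$. For a group $S$, $\operatorname{Sub}(S)$ is the lattice of subgroups of $S$ and $\operatorname{NSub}(S)$ is the lattice of normal subgroups of $S$. A group is non-Dedekind if it has a subgroup that is not normal. Construction. Given a group $S$, let $G=S\times S$, $T_1=S\times\{1\}$, $T_2=\{1\}\times S$, and $D=\{(x,x)\mid x\in S\}$. The signature has one unary operation symbol for each $g\in G$. - $\mathbf{A}$ has as universe the set $G/T_1$ of left cosets of $T_1$ in $G$, with operations $g^{\mathbf{A}}(xT_1)=(gx)T_1$ for $g\in G$. - $\mathbf{C}$ has as universe the set $G/T_2$ of left cosets of $T_2$ in $G$, with operations $g^{\mathbf{C}}(xT_2)=(gx)T_2$ for $g\in G$. - $\mathbf{B}$ has as universe the set $G/D$ of left cosets of $D$ in $G$, with operations $g^{\mathbf{B}}((x_1,x_2)D)=(g_2x_1,g_1x_2)D$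 for $g=(g_1,g_2)\in G$. *)

(* Defs.v *)
From HB Require Import structures.
From mathcomp Require Import all_boot all_order all_fingroup.
From mathcomp Require Import boolp.

Set Implicit Arguments.
Unset Strict Implicit.
Unset Printing Implicit Defensive.

Import Order.TTheory GroupScope.

(** * Universal algebra *)

Record signature := Signature {
  symbol : Type;
  arity : symbol -> nat
}.

(* Universes are nonempty, as is standard in universal algebra.  This matters
   for isotopy: any two algebras would be isotopic over an empty one. *)
Record algebra (sigma : signature) := Algebra {
  carrier :> Type;
  carrier_inhabited : inhabited carrier;
  op : forall s : symbol sigma, (arity s).-tuple carrier -> carrier
}.

Definition prod_op (sigma : signature) (A B : algebra sigma) (s : symbol sigma)
    (t : (arity s).-tuple (A * B)) : A * B :=
  (op (map_tuple fst t), op (map_tuple snd t)).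

Lemma prod_inhabited (X Y : Type) :
  inhabited X -> inhabited Y -> inhabited (X * Y).
Proof. by move=> [x] [y]; constructor. Qed.

Definition prod_algebra (sigma : signature) (A B : algebra sigma) :
    algebra sigma :=
  Algebra (prod_inhabited (carrier_inhabited A) (carrier_inhabited B))
    (@prod_op sigma A B).

Definition homomorphism (sigma : signature) (A B : algebra sigma)
    (f : A -> B) : Prop :=
  forall (s : symbol sigma) (t : (arity s).-tuple A),
    f (op t) = op (map_tuple f t).

Definition isomorphism (sigma : signature) (A B : algebra sigma)
    (f : A -> B) : Prop :=
  homomorphism f /\ bijective f.

Definition isotopic_over (sigma : signature) (C A B : algebra sigma) : Prop :=
  exists phi : prod_algebra A C -> prod_algebra B C,
    isomorphism phi /\ forall (a : A) (c : C), (phi (a, c)).2 = c.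

Definition isotopic (sigma : signature) (A B : algebra sigma) : Prop :=
  exists C : algebra sigma, isotopic_over C A B.

(** * Congruence lattices *)

(* Con, SubG and NSubG below are all ordered by inclusion. *)
Fact incl_display : Order.disp_t. Proof. exact: Order.Disp tt tt. Qed.

Definition compatible (sigma : signature) (A : algebra sigma)
    (R : A -> A -> Prop) : Prop :=
  forall (s : symbol sigma) (t u : (arity s).-tuple A),
    (forall i, R (tnth t i) (tnth u i)) -> R (op t) (op u).

Record Con (sigma : signature) (A : algebra sigma) := Congruence {
  con_rel :> A -> A -> Prop;
  con_equiv : RelationClasses.Equivalence con_rel;
  con_compat : compatible con_rel
}.

Section ConLattice.
Variables (sigma : signature) (A : algebra sigma).
Implicit Types R : Con A.

HB.instance Definition _ := gen_eqMixin (Con A).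
HB.instance Definition _ := gen_choiceMixin (Con A).

Lemma con_inj R1 R2 : con_rel R1 = con_rel R2 -> R1 = R2.
Proof.
case: R1 R2 => [r1 e1 c1] [r2 e2 c2] /= E; subst r2.
by congr Congruence; apply: Prop_irrelevance.
Qed.

Definition con_le R1 R2 : bool := `[< forall x y, R1 x y -> R2 x y >].

Lemma con_le_refl : reflexive con_le.
Proof. by move=> R; apply/asboolP. Qed.

Lemma con_le_anti : antisymmetric con_le.
Proof.
move=> R1 R2 /andP[/asboolP le12 /asboolP le21]; apply: con_inj.
apply/funext => x; apply/funext => y; apply/propext.
by split; [exact: le12 | exact: le21].
Qed.

Lemma con_le_trans : transitive con_le.
Proof.
move=> R2 R1 R3 /asboolP le12 /asboolP le23; apply/asboolP => x y R1xy.
exact/le23/le12.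
Qed.

HB.instance Definition _ := Order.Le_isPOrder.Build incl_display (Con A)
  con_le_refl con_le_anti con_le_trans.

Definition con_meet_rel R1 R2 (x y : A) : Prop := R1 x y /\ R2 x y.

Lemma con_meet_equiv R1 R2 :
  RelationClasses.Equivalence (con_meet_rel R1 R2).
Proof.
have [r1 s1 t1] := con_equiv R1; have [r2 s2 t2] := con_equiv R2; split.
- by move=> x; split.
- by move=> x y []; split; [exact: s1 | exact: s2].
- by move=> x y z [? ?] [? ?]; split; [exact: (t1 _ y) | exact: (t2 _ y)].
Qed.

Lemma con_meet_compat R1 R2 : compatible (con_meet_rel R1 R2).
Proof.
by move=> s t u tu; split; apply: con_compat => i; case: (tu i).
Qed.

Definition con_meet R1 R2 : Con A :=
  Congruence (con_meet_equiv R1 R2) (@con_meet_compat R1 R2).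

(* The congruence generated by R1 and R2. *)
Definition con_join_rel R1 R2 (x y : A) : Prop :=
  forall R, (forall a b, R1 a b -> R a b) -> (forall a b, R2 a b -> R a b) ->
    R x y.

Lemma con_join_equiv R1 R2 :
  RelationClasses.Equivalence (con_join_rel R1 R2).
Proof.
split.
- by move=> x R _ _; case: (con_equiv R).
- by move=> x y xy R l1 l2; case: (con_equiv R) => _ s _; apply/s/xy.
- move=> x y z xy yz R l1 l2; case: (con_equiv R) => _ _ t.
  by apply: (t _ y); [exact: xy | exact: yz].
Qed.

Lemma con_join_compat R1 R2 : compatible (con_join_rel R1 R2).
Proof.
by move=> s t u tu R l1 l2; apply: con_compat => i; apply: tu.
Qed.

Definition con_join R1 R2 : Con A :=
  Congruence (con_join_equiv R1 R2) (@con_join_compat R1 R2).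

Lemma con_meetP R R1 R2 :
  (R <= con_meet R1 R2)%O = (R <= R1)%O && (R <= R2)%O.
Proof.
apply/asboolP/andP => [le|[/asboolP le1 /asboolP le2] x y xy].
  by split; apply/asboolP => x y /le [].
by split; [exact: le1 | exact: le2].
Qed.

Lemma con_joinP R1 R2 R :
  (con_join R1 R2 <= R)%O = (R1 <= R)%O && (R2 <= R)%O.
Proof.
apply/asboolP/andP => [le|[/asboolP le1 /asboolP le2] x y xy].
  by split; apply/asboolP => x y xy; apply: le => Q l1 l2; auto.
exact: xy.
Qed.

HB.instance Definition _ :=
  Order.POrder_MeetJoin_isLattice.Build incl_display (Con A)
    con_meetP con_joinP.

End ConLattice.

(** * Lattices of (normal) subgroups *)

Definition SubG (S : finGroupType) := {group S}.

Section SubgroupLattice.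
Variable S : finGroupType.
Implicit Types H K L : SubG S.

HB.instance Definition _ := Finite.on (SubG S).

Definition subg_le H K : bool := H \subset K.
Definition subg_meet H K : SubG S := (H :&: K)%G.
Definition subg_join H K : SubG S := (H <*> K)%G.

Lemma subg_le_refl : reflexive subg_le.
Proof. by move=> H; apply: subxx. Qed.

Lemma subg_le_anti : antisymmetric subg_le.
Proof. by move=> H K sHK; apply/val_inj/eqP; rewrite eqEsubset. Qed.

Lemma subg_le_trans : transitive subg_le.
Proof. by move=> K H L; apply: subset_trans. Qed.

HB.instance Definition _ := Order.Le_isPOrder.Build incl_display
  (SubG S) subg_le_refl subg_le_anti subg_le_trans.

Lemma subg_meetP H K L : (H <= subg_meet K L)%O = (H <= K)%O && (H <= L)%O.
Proof. exact: subsetI. Qed.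

Lemma subg_joinP H K L : (subg_join H K <= L)%O = (H <= L)%O && (K <= L)%O.
Proof. exact: join_subG. Qed.

HB.instance Definition _ :=
  Order.POrder_MeetJoin_isLattice.Build incl_display (SubG S)
    subg_meetP subg_joinP.

Definition normal_subg : pred (SubG S) := fun H => H <| [set: S].

Lemma normal_subgI : meet_closed normal_subg.
Proof. by move=> H K; apply: normalI. Qed.

Lemma normal_subgU : join_closed normal_subg.
Proof. by move=> H K; apply: normalY. Qed.

End SubgroupLattice.

Definition NSubG (S : finGroupType) := {H : SubG S | normal_subg H}.

Section NormalSubgroupLattice.
Variable S : finGroupType.

HB.instance Definition _ := SubChoice.on (NSubG S).
HB.instance Definition _ := Order.SubChoice_isSubLattice.Build
  incl_display (SubG S) (@normal_subg S) incl_display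
  (NSubG S) (@normal_subgI S) (@normal_subgU S).

End NormalSubgroupLattice.

Definition non_Dedekind (S : finGroupType) : Prop :=
  exists H : {group S}, ~~ (H <| [set: S]).

Definition lattice_isomorphic d1 d2 (L : latticeType d1) (M : latticeType d2) :
    Prop :=
  exists f : {lmorphism L -> M}, bijective f.

(** * The algebras constructed from a finite group *)

Section CosetSpace.
Variables (gT : finGroupType) (H : {set gT}).

Definition coset_space := {X : {set gT} | X \in lcosets H [set: gT]}.

Lemma lcoset_in_lcosets (x : gT) : x *: H \in lcosets H [set: gT].
Proof. by apply/lcosetsP; exists x; rewrite ?inE. Qed.

Definition lcoset_pt (x : gT) : coset_space :=
  exist (fun X => X \in lcosets H [set: gT]) _ (lcoset_in_lcosets x).

Lemma translate_in_lcosets (g : gT) (X : coset_space) :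
  g *: val X \in lcosets H [set: gT].
Proof.
case/lcosetsP: (valP X) => x _ ->.
by apply/lcosetsP; exists (g * x); rewrite ?inE // lcosetM.
Qed.

Definition translate (g : gT) (X : coset_space) : coset_space :=
  exist (fun Y => Y \in lcosets H [set: gT]) _ (translate_in_lcosets g X).

Lemma translateE (g x : gT) : translate g (lcoset_pt x) = lcoset_pt (g * x).
Proof. by apply: val_inj; rewrite /= lcosetM. Qed.

End CosetSpace.

Section Construction.
Variable S : finGroupType.

Notation G := (S * S)%type.

Definition T1 : {set G} := setX [set: S] [1].
Definition T2 : {set G} := setX [1] [set: S].
Definition diagonal : {set G} := [set (x, x) | x : S].

Definition group_sig : signature := @Signature G (fun _ => 1%N).

Definition coset_algebra (H : {set G})
    (act : G -> coset_space H -> coset_space H) : algebra group_sig :=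
  @Algebra group_sig (coset_space H) (inhabits (lcoset_pt H 1))
    (fun g t => act g (thead t)).

Definition alg_A : algebra group_sig := coset_algebra (@translate _ T1).
Definition alg_C : algebra group_sig := coset_algebra (@translate _ T2).

(* The coordinates of g are swapped: see op_BE. *)
Definition alg_B : algebra group_sig :=
  coset_algebra (fun g : G => @translate _ diagonal (g.2, g.1)).

Lemma op_AE (g x : G) :
  @op _ alg_A g [tuple lcoset_pt T1 x] = lcoset_pt T1 (g * x).
Proof. exact: translateE. Qed.

Lemma op_CE (g x : G) :
  @op _ alg_C g [tuple lcoset_pt T2 x] = lcoset_pt T2 (g * x).
Proof. exact: translateE. Qed.

Lemma op_BE (g x : G) :
  @op _ alg_B g [tuple lcoset_pt diagonal x] =
  lcoset_pt diagonal (g.2 * x.1, g.1 * x.2).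
Proof. exact: translateE. Qed.

Definition phi_rel (p : prod_algebra alg_A alg_C)
    (q : prod_algebra alg_B alg_C) : Prop :=
  exists x1 x2 y1 y2 : S,
    p = (lcoset_pt T1 (x1, x2), lcoset_pt T2 (y1, y2)) /\
    q = (lcoset_pt diagonal (x2, y1), lcoset_pt T2 (y1, y2)).

End Construction.

(* Main.v *)
(** Reading a coset [(x1, x2) T1] as [x2] and [(x1, x2) D] as [x1 * x2^-1]
    identifies the universes of A and B with S; an operation
    [g = (g1, g2)] then acts on A by [s |-> g2 s] and on B by
    [s |-> g2 s g1^-1].  A congruence is determined by the class of 1,
    which is a subgroup of S, arbitrary in the case of A and invariant under
    conjugation in the case of B.  Since S is finite and NSub(S) is a proper
    subset of Sub(S), the two lattices differ already in cardinality. *)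

From HB Require Import structures.
Require Import Defs.
From mathcomp Require Import all_boot all_order all_fingroup.
From mathcomp Require Import boolp.

Set Implicit Arguments.
Unset Strict Implicit.
Unset Printing Implicit Defensive.

Import Order.TTheory GroupScope.

(** * Lattice isomorphisms from order isomorphisms *)

Section OrderIsomorphism.
Variables (d1 d2 : Order.disp_t) (L : latticeType d1) (M : latticeType d2).
Variables (f : L -> M) (g : M -> L).
Hypotheses (f_mono : {mono f : x y / (x <= y)%O}) (gK : cancel g f).

(** For the nontrivial inequality, [gK] writes the meet of [f x] and [f y] as an [f]-image, and
    [f_mono] turns the comparison into one in [L]. *)
Lemma order_iso_meet : {morph f : x y / Order.meet x y}.
Proof.
move=> x y; apply/le_anti; rewrite lexI !f_mono leIl leIr /=.
by rewrite -[X in (X <= _)%O]gK f_mono lexI -!f_mono gK leIl leIr.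
Qed.

Lemma order_iso_join : {morph f : x y / Order.join x y}.
Proof.
move=> x y; apply/le_anti; rewrite leUx !f_mono leUl leUr !andbT.
by rewrite -[X in (_ <= X)%O]gK f_mono leUx -!f_mono gK leUl leUr.
Qed.

Lemma order_iso_homo : {homo f : x y / (x <= y)%O}.
Proof. by move=> x y; rewrite f_mono. Qed.

HB.instance Definition _ := Order.isOrderMorphism.Build d1 L d2 M f
  order_iso_homo.
HB.instance Definition _ := Order.isLatticeMorphism.Build d1 L d2 M f
  order_iso_meet order_iso_join.

Lemma order_iso_lattice_isomorphic : lattice_isomorphic L M.
Proof.
exists (f : {lmorphism L -> M}); exists g => // x.
by apply/le_anti; rewrite -!f_mono gK lexx.
Qed.

End OrderIsomorphism.

Lemma surj_mono_lattice_isomorphic d1 d2 (L : latticeType d1)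
    (M : latticeType d2) (f : L -> M) :
  {mono f : x y / (x <= y)%O} -> (forall y, exists x, f x = y) ->
  lattice_isomorphic L M.
Proof.
move=> f_mono /(@choice _ _ (fun y x => f x = y))[g gK].
exact: order_iso_lattice_isomorphic f_mono gK.
Qed.

Lemma bij_lattice_isomorphic d1 d2 (L : latticeType d1) (M : latticeType d2) :
  lattice_isomorphic L M -> exists f : L -> M, bijective f.
Proof. by case=> f bij_f; exists f. Qed.

Lemma tuple1E (T : Type) (t : 1.-tuple T) : t = [tuple thead t].
Proof. by case/tupleP: t => x t; rewrite (tuple0 t); apply: val_inj. Qed.

(** * Congruences of S under the maps [s |-> g2 s (eta g1)^-1] *)

(* For [X := alg_A S] take [eta] trivial, for [X := alg_B S] the identity. *)
Section TwistedRegular.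
Variables (S : finGroupType) (X : algebra (group_sig S)).
Variables (eta : S -> S) (e : S -> X) (d : X -> S).
Hypotheses (eK : cancel e d) (dK : cancel d e) (eta1 : eta 1 = 1).
Hypothesis op_e : forall (g : S * S) (s : S),
  @op _ X g [tuple e s] = e (g.2 * s * (eta g.1)^-1).
Implicit Types (R : Con X) (K : {group S}).

Lemma con_act R g s t : R (e s) (e t) ->
  R (e (g.2 * s * (eta g.1)^-1)) (e (g.2 * t * (eta g.1)^-1)).
Proof.
move=> Rst; rewrite -!op_e.
by apply: (@con_compat _ _ R g) => i; rewrite !(tnth_nth (e 1)) [i]ord1.
Qed.

Lemma con_translate R x s t : R (e s) (e t) -> R (e (x * s)) (e (x * t)).
Proof. by move=> /(con_act (1, x)) /=; rewrite eta1 invg1 !mulg1. Qed.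

Definition con_class1 R : {set S} := [set k | `[< R (e 1) (e k) >]].

Lemma con_class1P R k : reflect (R (e 1) (e k)) (k \in con_class1 R).
Proof. by rewrite inE; apply: asboolP. Qed.

(** Left translations by [s^-1] and by [s] carry the pairs [(s, t)] and [(1, s^-1 * t)] to each
    other. *)
Lemma con_class1E R s t : R (e s) (e t) <-> s^-1 * t \in con_class1 R.
Proof.
split=> [Rst|/con_class1P/(con_translate s)]; last by rewrite mulg1 mulKVg.
by apply/con_class1P; rewrite -(mulVg s); apply: con_translate.
Qed.

(** Translating [1 R y] by [x] gives [x R (x * y)], which chains with [1 R x]. Inverses come for
    free because S is finite. *)
Lemma con_class1_group_set R : group_set (con_class1 R).
Proof.
have [refl _ trans] := con_equiv R.
apply/group_setP; split=> [|x y /con_class1P R1x /con_class1P R1y].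
  exact/con_class1P.
apply/con_class1P/(trans _ _ _ R1x).
by have := con_translate x R1y; rewrite mulg1.
Qed.

Definition con_subg R : {group S} := Group (con_class1_group_set R).

Definition eta_invariant K := forall g k, k \in K -> k ^ (eta g)^-1 \in K.

(** The operation [(g, eta g)] fixes [e 1] and acts on the class of 1 by conjugation. *)
Lemma con_subg_invariant R : eta_invariant (con_subg R).
Proof.
move=> g k /con_class1P/(con_act (g, eta g)) /=.
by rewrite mulg1 mulgV => R1; apply/con_class1P; rewrite conjgE invgK mulgA.
Qed.

Lemma con_subg_mono R1 R2 : (con_subg R1 \subset con_subg R2) = (R1 <= R2)%O.
Proof.
apply/subsetP/asboolP => [sR x y|leR k /con_class1P/leR]; last first.
  by move/con_class1P.
by rewrite -[x]dK -[y]dK !con_class1E; apply: sR.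
Qed.

Definition subg_rel K (x y : X) : Prop := (d x)^-1 * d y \in K.

Lemma subg_rel_equiv K : RelationClasses.Equivalence (subg_rel K).
Proof.
split=> [x|x y|x y z]; rewrite /subg_rel ?mulVg //.
- by rewrite -groupV invMg invgK.
- by move=> xy yz; have := groupM xy yz; rewrite mulgA mulgK.
Qed.

Lemma op_d (g : S * S) (t : 1.-tuple X) :
  d (@op _ X g t) = g.2 * d (thead t) * (eta g.1)^-1.
Proof. by rewrite [t in LHS]tuple1E -[thead t]dK op_e !eK. Qed.

(** In the quotient [(d x)^-1 * d y] the left factors [g.2] cancel, and [eta g.1] remains as a
    conjugation. *)
Lemma subg_rel_compat K : eta_invariant K -> compatible (subg_rel K).
Proof.
move=> invK g t u /(_ ord0) /(invK g.1); rewrite /subg_rel !op_d.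
by rewrite conjgE !invMg !mulgA mulgKV.
Qed.

Lemma con_subg_surj K : eta_invariant K -> exists R, con_subg R = K.
Proof.
move=> invK.
exists (Congruence (subg_rel_equiv K) (subg_rel_compat invK)).
apply/val_inj/setP => k; rewrite inE /= /subg_rel !eK invg1 mul1g.
exact: asboolb.
Qed.

Lemma Con_SubG_isomorphic :
  (forall K, eta_invariant K) -> lattice_isomorphic (Con X) (SubG S).
Proof.
move=> inv; apply: (@surj_mono_lattice_isomorphic _ _ _ (SubG S) con_subg).
  exact: con_subg_mono.
by move=> K; apply: con_subg_surj.
Qed.

Lemma Con_NSubG_isomorphic :
  (forall K, eta_invariant K <-> K <| [set: S]) ->
  lattice_isomorphic (Con X) (NSubG S).
Proof.
move=> invP.
have nR R : normal_subg (con_subg R) by apply/invP/con_subg_invariant.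
pose f R : NSubG S := exist _ (con_subg R) (nR R).
apply: (@surj_mono_lattice_isomorphic _ _ _ (NSubG S) f) => [R1 R2|[K nK]].
  exact: con_subg_mono.
have [R RK] := con_subg_surj (proj2 (invP K) nK).
by exists R; apply: val_inj.
Qed.

End TwistedRegular.

(** * Cosets and their coordinates in S *)

Lemma lcoset_pt_surj (gT : finGroupType) (H : {set gT}) (X : coset_space H) :
  exists x, X = lcoset_pt H x.
Proof. by case/lcosetsP: (valP X) => x _ E; exists x; apply: val_inj. Qed.

Lemma eq_lcoset_pt (gT : finGroupType) (H : {set gT}) (x y : gT) :
  group_set H -> lcoset_pt H x = lcoset_pt H y <-> x^-1 * y \in H.
Proof.
move=> gH; rewrite -mem_lcoset.
split=> [/(congr1 val) /= ->|E]; last first.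
  exact/val_inj/esym/(@lcoset_eqP _ (Group gH)).
exact: (lcoset_refl (Group gH)).
Qed.

Section CosetAlgebras.
Variable S : finGroupType.

Lemma T1_group_set : group_set (T1 S).
Proof. exact: (groupP (setX_group [set: S]%G 1%G)). Qed.

Lemma T2_group_set : group_set (T2 S).
Proof. exact: (groupP (setX_group 1%G [set: S]%G)). Qed.

Lemma mem_diagonal (x : S * S) : (x \in diagonal S) = (x.1 == x.2).
Proof.
apply/imsetP/eqP => [[s _ ->]|] //.
by case: x => s t /= <-; exists s.
Qed.

Lemma diagonal_group_set : group_set (diagonal S).
Proof.
apply/group_setP; split=> [|x y]; rewrite !mem_diagonal //=.
by move=> /eqP-> /eqP->.
Qed.

Lemma eq_lcoset_T1 x y :
  lcoset_pt (T1 S) x = lcoset_pt (T1 S) y <-> x.2 = y.2.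
Proof.
rewrite (eq_lcoset_pt _ _ T1_group_set) !inE /=.
by split=> [/eqP/(canRL (mulKVg _))|->]; rewrite ?mulg1 ?mulVg.
Qed.

Lemma eq_lcoset_T2 x y :
  lcoset_pt (T2 S) x = lcoset_pt (T2 S) y <-> x.1 = y.1.
Proof.
rewrite (eq_lcoset_pt _ _ T2_group_set) !inE andbT /=.
by split=> [/eqP/(canRL (mulKVg _))|->]; rewrite ?mulg1 ?mulVg.
Qed.

Lemma eq_lcoset_diagonal x y :
  lcoset_pt (diagonal S) x = lcoset_pt (diagonal S) y <->
  x.1 * x.2^-1 = y.1 * y.2^-1.
Proof.
rewrite (eq_lcoset_pt _ _ diagonal_group_set) mem_diagonal /=.
split=> [/eqP/(canRL (mulKVg _)) E|E].
  by rewrite E /= mulgA mulgK.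
by rewrite -(mulgKV y.2 y.1) -E !mulgA mulVg mul1g.
Qed.

(** The coordinates are read off a chosen representative; [coordAE], [coordCE] and [coordBE] show
    that the choice is immaterial. *)
Definition coordA (X : alg_A S) : S := (repr (val X)).2.
Definition coordC (X : alg_C S) : S := (repr (val X)).1.
Definition coordB (X : alg_B S) : S := (repr (val X)).1 * (repr (val X)).2^-1.

Lemma lcoset_pt_repr (H : {set S * S}) (X : coset_space H) :
  group_set H -> lcoset_pt H (repr (val X)) = X.
Proof.
move=> gH; have [x ->] := lcoset_pt_surj X.
apply/esym/(eq_lcoset_pt _ _ gH); rewrite -mem_lcoset.
exact: (mem_repr x (lcoset_refl (Group gH) x)).
Qed.

Lemma coordAE x : coordA (lcoset_pt (T1 S) x) = x.2.
Proof. exact/eq_lcoset_T1/lcoset_pt_repr/T1_group_set. Qed.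

Lemma coordCE x : coordC (lcoset_pt (T2 S) x) = x.1.
Proof. exact/eq_lcoset_T2/lcoset_pt_repr/T2_group_set. Qed.

Lemma coordBE x : coordB (lcoset_pt (diagonal S) x) = x.1 * x.2^-1.
Proof. exact/eq_lcoset_diagonal/lcoset_pt_repr/diagonal_group_set. Qed.

Definition pointA (s : S) : alg_A S := lcoset_pt (T1 S) (1, s).
Definition pointB (s : S) : alg_B S := lcoset_pt (diagonal S) (s, 1).

Lemma pointAK : cancel pointA coordA.
Proof. by move=> s; rewrite coordAE. Qed.

Lemma coordAK : cancel coordA pointA.
Proof.
move=> X; have [x ->] := lcoset_pt_surj X.
by apply/eq_lcoset_T1; rewrite coordAE.
Qed.

Lemma pointBK : cancel pointB coordB.
Proof. by move=> s; rewrite coordBE invg1 mulg1. Qed.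

Lemma coordBK : cancel coordB pointB.
Proof.
move=> X; have [x ->] := lcoset_pt_surj X.
by apply/eq_lcoset_diagonal; rewrite coordBE invg1 mulg1.
Qed.

Lemma Con_A_isomorphic : lattice_isomorphic (Con (alg_A S)) (SubG S).
Proof.
apply: (Con_SubG_isomorphic (eta := fun _ => 1) pointAK coordAK) => //.
  by move=> g s; rewrite op_AE; apply/eq_lcoset_T1; rewrite invg1 mulg1.
by move=> K g k kK; rewrite invg1 conjg1.
Qed.

Lemma Con_B_isomorphic : lattice_isomorphic (Con (alg_B S)) (NSubG S).
Proof.
apply: (Con_NSubG_isomorphic (eta := id) pointBK coordBK) => //.
  move=> g s; rewrite op_BE; apply/eq_lcoset_diagonal => /=.
  by rewrite mulg1 invg1 mulg1.
move=> K; rewrite /normal subsetT /=; split=> [invK|nK g k kK].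
  apply/subsetP => g _; rewrite inE; apply/subsetP => _ /imsetP[k kK ->].
  (* Invariance speaks of conjugation by inverses, so it is applied to [g^-1]. *)
  by rewrite -[g]invgK; apply: invK.
by rewrite memJ_norm // (subsetP nK) // inE.
Qed.

(** * The isomorphism from A x C to B x C *)

Definition phi (p : prod_algebra (alg_A S) (alg_C S)) :
    prod_algebra (alg_B S) (alg_C S) :=
  (lcoset_pt (diagonal S) (coordA p.1, coordC p.2), p.2).

(** In coordinates [phi] is [(s, c) |-> (s * c^-1, c)], so the inverse multiplies by [c]. *)
Definition phi_inv (q : prod_algebra (alg_B S) (alg_C S)) :
    prod_algebra (alg_A S) (alg_C S) :=
  (pointA (coordB q.1 * coordC q.2), q.2).

Lemma phi_relP p q : phi_rel p q <-> phi p = q.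
Proof.
split=> [[x1 [x2 [y1 [y2 [-> ->]]]]]|<-].
  by rewrite /phi coordAE coordCE.
case: p => X Y; have [[x1 x2] ->] := lcoset_pt_surj X.
have [[y1 y2] ->] := lcoset_pt_surj Y.
by exists x1, x2, y1, y2; rewrite /phi coordAE coordCE.
Qed.

Lemma phiK : cancel phi phi_inv.
Proof. by case=> X Y; rewrite /phi_inv /= coordBE /= mulgKV coordAK. Qed.

Lemma phi_invK : cancel phi_inv phi.
Proof.
case=> X Y; rewrite /phi /= pointAK; congr pair.
rewrite -[RHS]coordBK; apply/eq_lcoset_diagonal => /=.
by rewrite mulgK invg1 mulg1.
Qed.

Lemma phi_homomorphism : homomorphism phi.
Proof.
move=> g t; rewrite (tuple1E t); case: (thead t) => X Y.
have [x ->] := lcoset_pt_surj X; have [y ->] := lcoset_pt_surj Y.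
(* Representatives are multiplied by [g]. The pair [(x.2, y.1)] goes to [(g.2 * x.2, g.1 * y.1)],
   which is why the operations of B swap the coordinates of [g]. *)
apply/phi_relP; exists (g.1 * x.1), (g.2 * x.2), (g.1 * y.1), (g.2 * y.2).
split; congr pair; apply: val_inj.
- by rewrite /= -lcosetM.
- by rewrite /= -lcosetM.
- by rewrite /= coordAE coordCE -lcosetM.
- by rewrite /= -lcosetM.
Qed.

Lemma phi_isomorphism : isomorphism phi.
Proof.
by split; [exact: phi_homomorphism | exists phi_inv; [exact: phiK | exact: phi_invK]].
Qed.

Lemma alg_isotopic_over : isotopic_over (alg_C S) (alg_A S) (alg_B S).
Proof. by exists phi; split; [exact: phi_isomorphism|]. Qed.

(** * Non-isomorphic congruence lattices *)

Lemma Con_not_isomorphic :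
  non_Dedekind S -> ~ lattice_isomorphic (Con (alg_A S)) (Con (alg_B S)).
Proof.
case=> H nnH /bij_lattice_isomorphic[f bij_f].
have [a [a' aK a'K]] := bij_lattice_isomorphic Con_A_isomorphic.
have [b bij_b] := bij_lattice_isomorphic Con_B_isomorphic.
(* An injective self-map of the finite set Sub(S) with only normal values: being surjective, it
   would make [H] normal. *)
pose h (K : {group S}) : {group S} := val (b (f (a' K))).
have inj_h : injective h.
  by move=> K L /val_inj/(bij_inj bij_b)/(bij_inj bij_f)/(can_inj a'K).
case/negP: nnH; rewrite -(f_invF inj_h H).
exact: valP (b (f (a' (invF inj_h H)))).
Qed.

End CosetAlgebras.

(** A point stabilizer is not normal: [(a b)] fixes [c], but its conjugate [(a c)] under [(b c)]
    does not. *)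
Lemma non_Dedekind_S3 : non_Dedekind {perm 'I_3}.
Proof.
pose a : 'I_3 := inord 0; pose b : 'I_3 := inord 1; pose c : 'I_3 := inord 2.
have [ab bc ac] : [/\ a != b, b != c & a != c].
  by rewrite -!val_eqE /= !inordK.
exists ('C[c | 'P])%G; apply/negP => /andP[_ nH].
have fix_c : tperm a b \in 'C[c | 'P].
  by apply/astab1P; rewrite /= /aperm tpermD.
have := memJ_norm (tperm a b) (subsetP nH (tperm b c) (in_setT _)).
rewrite fix_c tpermJ tpermL tpermD 1?eq_sym // => /astab1P.
by rewrite /= /aperm tpermR; apply/eqP.
Qed.

Theorem mainTheorem1 :
  (forall S : finGroupType, non_Dedekind S ->
     (exists phi : prod_algebra (alg_A S) (alg_C S) ->
                   prod_algebra (alg_B S) (alg_C S),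
        (forall p q, phi_rel p q <-> phi p = q) /\ isomorphism phi) /\
     isotopic_over (alg_C S) (alg_A S) (alg_B S) /\
     isotopic (alg_A S) (alg_B S) /\
     lattice_isomorphic (Con (alg_A S)) (SubG S) /\
     lattice_isomorphic (Con (alg_B S)) (NSubG S) /\
     [set H : {group S} | H <| [set: S]]%g \proper [set: {group S}] /\
     ~ lattice_isomorphic (Con (alg_A S)) (Con (alg_B S))) /\
  (exists (sigma : signature) (A B : algebra sigma),
     isotopic A B /\ ~ lattice_isomorphic (Con A) (Con B)).
Proof.
have isoAB S : isotopic (alg_A S) (alg_B S).
  by exists (alg_C S); apply: alg_isotopic_over.
split=> [S nD|]; last first.
  (* The pure existence claim needs a concrete non-Dedekind group, here the symmetric group on three
     points. *)
  exists (group_sig {perm 'I_3}), (alg_A _), (alg_B _); split=> //.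
  exact/Con_not_isomorphic/non_Dedekind_S3.
split; first by exists (@phi S); split; [exact: phi_relP | exact: phi_isomorphism].
split; first exact: alg_isotopic_over.
split; first exact: isoAB.
split; first exact: Con_A_isomorphic.
split; first exact: Con_B_isomorphic.
split; last exact: Con_not_isomorphic.
have [H nnH] := nD.
by apply/properP; split; [exact: subsetT | exists H; rewrite !inE].
Qed.
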